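(* Let $k=2$ and let $c_1\le c_2$ be real numbers. Consider the following scheme for $\partial_tu+\partial_xf(u)=\partial_x(A(x,u)\partial_xu)$ on a uniform mesh with periodic boundary conditions: given $u_h^n\in V_h$, find $u_h^{n+1}\in V_h$ such that for all $v\in V_h$ and $j=1,\dots,N$, $$\begin{aligned}\int_{I_j}\frac{u_h^{n+1}-u_h^n}{\tau}v\,dx=&\int_{I_j}f(u_h^n)\partial_xv\,dx-\hat f\big((u_h^n)^-,(u_h^n)^+\big)v\Big|_{x_{j-\frac12}}^{x_{j+\frac12}}-\int_{I_j}A_h^n\,\partial_xu_h^n\,\partial_xv\,dx\\&+\{A_h^n\}\big[\widehat{\partial_xu_h^n}\,v+(u_h^n-\{u_h^n\})\partial_xv\big]\Big|_{x_{j-\frac12}}^{x_{j+\frac12}},\end{aligned}$$ with flux parameters satisfying $$\beta_0\ge1\quad\text{and}\quad\tfrac18\le\beta_1\le\tfrac14 .$$ Let $\gamma$ satisfy $$-\tfrac13<\gamma<\tfrac13\quad\text{and}\quad|\gamma|\le8\beta_1-1,$$ and set $S_j=x_j+\frac h2\{-1,\gamma,1\}$. Let $\lambda=\tau/h$, $\mu=\tau/h^2$ and assume the CFL conditions $\lambda\le\lambda_0$, $\mu\le\mu_0$, where $$\lambda_0=\frac1{2\mathcal L}\min\Big\{\frac{1+3\gamma}{6(1+\gamma)},\ \frac{1-3\gamma}{6(1-\gamma)}\Big\},$$ $$\mu_0=\frac1{12}\Big(\max_{1\le j\le N}\{A_h^n\}_{j+\frac12}\Big)^{-1}\min\left\{\frac{1+3\gamma}{\beta_0(1+\gamma)+8\beta_1-2},\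 \frac{1-3\gamma}{\beta_0(1-\gamma)+8\beta_1-2},\ \frac{2}{1-4\beta_1}\right\}.$$ Then the scheme is maximum-principle-satisfying: if $u_h^n(x)\in[c_1,c_2]$ on $S_j$ for all $j=1,\dots,N$, then $\bar u_j^{n+1}\in[c_1,c_2]$ for all $j=1,\dots,N$.
   Context: Setting. $\Omega=\bigcup_{j=1}^NI_j$ is an interval partitioned into cells $I_j=[x_{j-\frac12},x_{j+\frac12}]$ of uniform length $h$ with midpoints $x_j$; periodic boundary conditions. $V_h=\{v\in L^2(\Omega):v|_{I_j}\in P^k(I_j),\ j=1,\dots,N\}$, $P^k$ being polynomials of degree at most $k$; $\tau>0$ is the time step. $f$ is smooth, $A(x,u)\ge0$, $A_h^n=A(x,u_h^n)$. At a cell interface, $v^\mp$ are the left/right limits, $[v]=v^+-v^-$, $\{v\}=\frac12(v^++v^-)$; $\{A_h^n\}_{j+\frac12}$ is the average of $A_h^n$ at $x_{j+\frac12}$. In boundary terms on $\partial I_j$, $v$, $\partial_xv$ and the unbraced $u_h^n$ are traces from inside $I_j$. By periodicity left limits at $x_{\frac12}$ are those at $x_{N+\frac12}$ and right limits at $x_{N+\frac12}$ those at $x_{\frac12}$. Values of $u_h^n$ on $S_j$ are those of the polynomial $u_h^n|_{I_j}$ (one-sided limits from inside at endpoints). The cell average is $\bar u_j=\frac1h\int_{I_j}u_h\,dx$. Diffusive flux at $x_{j+\frac12}$: $\widehat{\partial_xv}=\frac{\beta_0}h[v]+\{\partial_xv\}+\beta_1h[\partial_x^2v]$. Convective flux: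 $\hat f(u,v)$ is any monotone numerical flux, i.e. Lipschitz continuous (with Lipschitz constant $\mathcal L$ in each argument on $[c_1,c_2]$), nondecreasing in $u$, nonincreasing in $v$, and consistent: $\hat f(u,u)=f(u)$. (For the global Lax–Friedrichs flux $\hat f(u,v)=\frac12(f(u)+f(v)-\sigma(v-u))$ with $\sigma=\max_{[c_1,c_2]}|f'|$ one has $\mathcal L=\max_{[c_1,c_2]}|f'|$.) A quotient with zero denominator in $\lambda_0$ or $\mu_0$ is read as $+\infty$ (no restriction). *)

(* Defs.v *)
From mathcomp Require Import all_boot all_order all_algebra.
From mathcomp Require Import all_classical all_reals all_analysis.

Set Implicit Arguments.
Unset Strict Implicit.
Unset Printing Implicit Defensive.

Import Order.TTheory GRing.Theory Num.Theory numFieldNormedType.Exports.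

Local Open Scope classical_set_scope.
Local Open Scope ring_scope.

Definition smooth (R : realType) (f : R -> R) : Prop :=
  forall (n : nat) (x : R), derivable (derive1n n f) x 1.

(* Everything but consistency is required on [c1, c2] only: the global
   Lax-Friedrichs flux, with sigma = max |f'| over [c1, c2], is in general
   neither monotone nor L-Lipschitz outside [c1, c2]. *)
Record monotone_flux (R : realType) (f : R -> R) (c1 c2 L : R)
    (fhat : R -> R -> R) : Prop := MonotoneFlux {
  flux_lipschitz_l :
    {in `[c1, c2], forall v, L.-lipschitz_[set` `[c1, c2]] (fhat^~ v)};
  flux_lipschitz_r :
    {in `[c1, c2], forall u, L.-lipschitz_[set` `[c1, c2]] (fhat u)};
  flux_nondecreasing_l :
    {in `[c1, c2], forall v,
      {in `[c1, c2] &, {homo fhat^~ v : u u' / u <= u'}}};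
  flux_nonincreasing_r :
    {in `[c1, c2], forall u,
      {in `[c1, c2] &, {homo fhat u : v v' /~ v <= v'}}};
  flux_consistent : forall u, fhat u u = f u }.

Section DG.
Variables (R : realType) (N : nat).

(* Uniform mesh of Omega = [a, a + N h]. Cells are numbered from 0, and the
   interface with index j is the right end of cell j. By periodicity, the cell
   to the right of interface j is ordS j, and the left end of cell j is
   interface ord_pred j. *)
Variables (a h : R).

Definition xl (j : 'I_N) : R := a + h *+ j.
Definition xr (j : 'I_N) : R := a + h *+ j.+1.
Definition xmid (j : 'I_N) : R := (xl j + xr j) / 2.
Definition cell (j : 'I_N) : set R := [set` `[xl j, xr j]].

(* A broken function is given by one function per cell; the values of the j-th
   one matter only on cell j. The limits below are one-sided limits from inside
   cell j at its two ends. *)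
Definition inner_r (w : 'I_N -> R -> R) (j : 'I_N) : R :=
  lim (w j x @[x --> (xr j)^'-]).
Definition inner_l (w : 'I_N -> R -> R) (j : 'I_N) : R :=
  lim (w j x @[x --> (xl j)^'+]).

Definition trm (w : 'I_N -> R -> R) (j : 'I_N) : R := inner_r w j.
Definition trp (w : 'I_N -> R -> R) (j : 'I_N) : R := inner_l w (ordS j).
Definition jump (w : 'I_N -> R -> R) (j : 'I_N) : R := trp w j - trm w j.
Definition avg (w : 'I_N -> R -> R) (j : 'I_N) : R := (trm w j + trp w j) / 2.

(* Elements of V_h are represented by their polynomial on each cell. *)
Definition in_Vh (k : nat) (v : 'I_N -> {poly R}) : Prop :=
  forall j, (size (v j) <= k.+1)%N.

(* The n-th broken derivative. *)
Definition dV (n : nat) (v : 'I_N -> {poly R}) : 'I_N -> R -> R :=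
  fun j x => ((v j)^`(n)).[x].

Definition cell_average (v : 'I_N -> {poly R}) (j : 'I_N) : R :=
  h^-1 * \int[lebesgue_measure]_(x in cell j) dV 0 v j x.

Definition Spoints (gamma : R) (j : 'I_N) : seq R :=
  [seq xmid j + h / 2 * s | s <- [:: -1; gamma; 1]].

Definition diff_flux (beta0 beta1 : R) (v : 'I_N -> {poly R}) (j : 'I_N) : R :=
  beta0 / h * jump (dV 0 v) j + avg (dV 1 v) j
  + beta1 * h * jump (dV 2 v) j.

Definition conv_flux (fhat : R -> R -> R) (u : 'I_N -> {poly R}) (j : 'I_N) : R
  := fhat (trm (dV 0 u) j) (trp (dV 0 u) j).

Definition Ah (A : R -> R -> R) (u : 'I_N -> {poly R}) : 'I_N -> R -> R :=
  fun j x => A x (dV 0 u j x).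

Definition ddg_step (k : nat) (f : R -> R) (fhat A : R -> R -> R)
    (beta0 beta1 tau : R) (u u' : 'I_N -> {poly R}) : Prop :=
  forall v, in_Vh k v -> forall j : 'I_N,
  let i := ord_pred j in
  \int[lebesgue_measure]_(x in cell j)
    ((dV 0 u' j x - dV 0 u j x) / tau * dV 0 v j x)
  = \int[lebesgue_measure]_(x in cell j) (f (dV 0 u j x) * dV 1 v j x)
    - (conv_flux fhat u j * inner_r (dV 0 v) j
       - conv_flux fhat u i * inner_l (dV 0 v) j)
    - \int[lebesgue_measure]_(x in cell j)
        (Ah A u j x * dV 1 u j x * dV 1 v j x)
    + (avg (Ah A u) j *
         (diff_flux beta0 beta1 u j * inner_r (dV 0 v) j
          + (inner_r (dV 0 u) j - avg (dV 0 u) j) * inner_r (dV 1 v) j)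
       - avg (Ah A u) i *
         (diff_flux beta0 beta1 u i * inner_l (dV 0 v) j
          + (inner_l (dV 0 u) j - avg (dV 0 u) i) * inner_l (dV 1 v) j)).

(* In \bar R, the inverse of 0 is +oo; all the numerators below are positive
   when `|gamma| < 1/3. *)
Definition lambda0 (L gamma : R) : \bar R :=
  ((2 * L)%:E^-1 *
   mine ((1 + 3 * gamma)%:E / (6 * (1 + gamma))%:E)
        ((1 - 3 * gamma)%:E / (6 * (1 - gamma))%:E))%E.

Definition mu0 (A : R -> R -> R) (u : 'I_N -> {poly R})
    (beta0 beta1 gamma : R) : \bar R :=
  ((12^-1)%:E * (\big[maxe/-oo]_(j < N) (avg (Ah A u) j)%:E)^-1 *
   mine ((1 + 3 * gamma)%:E / (beta0 * (1 + gamma) + 8 * beta1 - 2)%:E)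
     (mine ((1 - 3 * gamma)%:E / (beta0 * (1 - gamma) + 8 * beta1 - 2)%:E)
           (2%:E / (1 - 4 * beta1)%:E)))%E.

End DG.

(* Main.v *)
Require Import Defs.
From mathcomp Require Import all_boot all_order all_algebra.
From mathcomp Require Import all_classical all_reals all_analysis.
From mathcomp Require Import ring lra.
Import Order.TTheory GRing.Theory Num.Theory numFieldNormedType.Exports.
Local Open Scope classical_set_scope.
Local Open Scope ring_scope.

Set Implicit Arguments.
Unset Strict Implicit.
Unset Printing Implicit Defensive.

(** The idea is to test the scheme with the constant 1, and to read the resulting
update of the cell average as a function of point values of [u] at the three
nodes of the cell and of its two neighbours.

On a cell, a polynomial of degree at most 2 is determined by its values at the
reference nodes -1, gamma, 1. Its average is the interpolatory quadrature
[nodal_average], with positive weights w1, w2, w3 when |gamma| < 1/3, and h times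
the diffusive flux through an interface is a linear form [nodal_flux] in six
nodal values. Testing with 1 kills every term with a derivative of the test
function and gives ([average_update])

  average' = w1 l + w2 m + w3 r - lambda (fhat(r, l+) - fhat(r-, l))
             + mu (A+ F+ - A- F-),

where l, m, r are the values at the nodes of the cell, l+ and r- are the
neighbouring endpoint values, A+, A- are the interface averages of A, and F+, F-
are the values of [nodal_flux]. The endpoint weights are shared equally:

- w1/2 and w3/2 go to convection. Since fhat is monotone, raising r- or l+
  does not lower the average; since fhat is L-Lipschitz, the loss when l or r
  is raised is at most lambda L per unit, hence at most w1/2 and w3/2. So the
  convective part is nondecreasing ([flux_difference_monotone]), and it is
  (w1/2 + w3/2) c when all its arguments equal c.
- w1/2 and w3/2 go to diffusion, together with the whole of w2, as convection
  does not see the middle node. In [nodal_flux] the values on the left of the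
  interface have nonpositive coefficients and those on the right nonnegative
  ones, because beta0 >= 1, beta1 <= 1/4 and |gamma| <= 8 beta1 - 1. So
  only the coefficients of l, m and r in the diffusive part can be negative, and
  the bound on mu makes them nonnegative too ([diffusion_ge0]).

The two parts add up to a nondecreasing function of the nodal values which
returns c when all of them equal c. The nodal values lie in [c1, c2], hence so
does the new average. *)

(** * Quadratic polynomials through their nodal values *)

(** The weights are the averages over [-1, 1] of the Lagrange polynomials at the
nodes -1, g, 1. *)
Definition nodal_average {R : realType} (g : R) (vl vm vr : R) : R :=
  (1 + 3 * g) / (6 * (1 + g)) * vl + 2 / (3 * (1 - g ^+ 2)) * vm
  + (1 - 3 * g) / (6 * (1 - g)) * vr.

(** The second divided difference at the nodes -1, g, 1, that is, half the second
derivative of the interpolant on the reference cell. *)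
Definition nodal_curvature {R : realType} (g : R) (vl vm vr : R) : R :=
  vl / (2 * (1 + g)) - vm / (1 - g ^+ 2) + vr / (2 * (1 - g)).

Definition mid_node {R : realType} (g h l : R) : R := l + h / 2 * (1 + g).

Lemma reference_nodes_distinct (R : realType) (g : R) :
  -1 < g < 1 -> [/\ 1 + g != 0, 1 - g != 0 & 1 - g ^+ 2 != 0].
Proof.
by move=> /andP[g1 g2]; split; [lra | lra | rewrite lt0r_neq0//; nra].
Qed.

Lemma nodal_average_cst (R : realType) (g c : R) :
  -1 < g < 1 -> nodal_average g c c c = c.
Proof.
move=> /reference_nodes_distinct[gD gB gS]; rewrite /nodal_average.
by field; rewrite ?gD ?gB ?gS.
Qed.

Lemma horner_quadratic (R : realType) (p : {poly R}) (x : R) :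
  (size p <= 3)%N -> p.[x] = p`_0 + p`_1 * x + p`_2 * x ^+ 2.
Proof.
by move=> sp; rewrite (horner_coef_wide x sp) !big_ord_recl big_ord0 /=; ring.
Qed.

Lemma size_deriv_quadratic (R : realType) (p : {poly R}) :
  (size p <= 3)%N -> (size p^`() <= 3)%N.
Proof.
have [->|p0 sp] := eqVneq p 0; first by rewrite deriv0 size_poly0.
exact: leq_trans (ltnW (lt_size_deriv p0)) sp.
Qed.

Lemma horner_deriv_quadratic (R : realType) (p : {poly R}) (x : R) :
  (size p <= 3)%N -> p^`().[x] = p`_1 + p`_2 * x *+ 2.
Proof.
move=> sp; rewrite (horner_quadratic x (size_deriv_quadratic sp)).
rewrite !coef_deriv [p`_3]nth_default//.
by ring.
Qed.

Lemma horner_deriv2_quadratic (R : realType) (p : {poly R}) (x : R) :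
  (size p <= 3)%N -> p^`(2).[x] = p`_2 *+ 2.
Proof.
move=> sp; rewrite derivnS derivn1.
rewrite horner_deriv_quadratic ?size_deriv_quadratic// !coef_deriv.
by rewrite [p`_3]nth_default//; ring.
Qed.

Lemma Rintegral_quadratic (R : realType) (g l h : R) (p : {poly R}) :
  0 < h -> -1 < g < 1 -> (size p <= 3)%N ->
  \int[lebesgue_measure]_(x in `[l, l + h]) p.[x] =
  h * nodal_average g p.[l] p.[mid_node g h l] p.[l + h].
Proof.
move=> h0 g1 sp; have [gD gB gS] := reference_nodes_distinct g1.
pose F : {poly R} := p`_0 *: 'X + (p`_1 / 2) *: 'X^2 + (p`_2 / 3) *: 'X^3.
have FE : F^`() = p.
  rewrite /F !poly.derivE; apply/polyP => -[|[|[|i]]]; rewrite !coefE //=.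
  - by rewrite !mulr0n; ring.
  - by field.
  - by field.
  - by rewrite [p`_i.+3]nth_default ?(leq_trans sp)//; ring.
rewrite /Rintegral (@continuous_FTC2 _ _ (horner F)) ?ltrDl//=.
- rewrite /F /nodal_average /mid_node !(horner_quadratic (p := p))//.
  rewrite !(hornerD, hornerZ, hornerXn, hornerX).
  by field; rewrite gD gB gS.
- by apply: continuous_subspaceT; exact: continuous_horner.
- split=> [x _||].
  + exact: derivable_horner.
  + by apply: cvg_at_right_filter; exact: continuous_horner.
  + by apply: cvg_at_left_filter; exact: continuous_horner.
- by move=> x _; rewrite -derivE FE.
Qed.

(** In reference coordinates h p' is 2 dp/ds and h^2 p'' is 4 d^2p/ds^2. The slope
of a quadratic at s = 1 or s = -1 is that of its chord plus or minus twice its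
curvature, so the average of derivatives contributes the two chords and
2 (curv1 - curv2), while the jump of second derivatives contributes
8 b1 (curv2 - curv1). *)
Definition nodal_flux {R : realType} (g b0 b1 l1 m1 r1 l2 m2 r2 : R) : R :=
  b0 * (l2 - r1) + (r1 - l1) / 2 + (r2 - l2) / 2 +
  (2 - 8 * b1) * (nodal_curvature g l1 m1 r1 - nodal_curvature g l2 m2 r2).

Lemma nodal_fluxB (R : realType) (g b0 b1 c l1 m1 r1 l2 m2 r2 : R) :
  nodal_flux g b0 b1 (l1 - c) (m1 - c) (r1 - c) (l2 - c) (m2 - c) (r2 - c) =
  nodal_flux g b0 b1 l1 m1 r1 l2 m2 r2.
Proof. by rewrite /nodal_flux /nodal_curvature; ring. Qed.

Lemma nodal_fluxN (R : realType) (g b0 b1 l1 m1 r1 l2 m2 r2 : R) :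
  nodal_flux g b0 b1 (- l1) (- m1) (- r1) (- l2) (- m2) (- r2) =
  - nodal_flux g b0 b1 l1 m1 r1 l2 m2 r2.
Proof. by rewrite /nodal_flux /nodal_curvature; ring. Qed.

Lemma diff_flux_nodal (R : realType) (g h l r b0 b1 : R) (p q : {poly R}) :
  0 < h -> -1 < g < 1 -> (size p <= 3)%N -> (size q <= 3)%N ->
  b0 / h * (q.[r] - p.[l + h]) + (p^`().[l + h] + q^`().[r]) / 2 +
   b1 * h * (q^`(2).[r] - p^`(2).[l + h]) =
  nodal_flux g b0 b1 p.[l] p.[mid_node g h l] p.[l + h]
                   q.[r] q.[mid_node g h r] q.[r + h] / h.
Proof.
move=> h0 g1 sp sq; have [gD gB gS] := reference_nodes_distinct g1.
rewrite !horner_deriv2_quadratic// !horner_deriv_quadratic//.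
rewrite /nodal_flux /nodal_curvature /mid_node.
rewrite !(horner_quadratic (p := p))// !(horner_quadratic (p := q))//.
by field; rewrite ?gD ?gB ?gS //; lra.
Qed.

(** * Traces and mesh geometry *)

Lemma trace_r_continuous (R : realType) (N : nat) (a h : R)
    (w : 'I_N -> R -> R) (j : 'I_N) :
  continuous (w j) -> inner_r a h w j = w j (xr a h j).
Proof.
by move=> cw; apply: cvg_lim => //; apply: cvg_at_left_filter; exact: cw.
Qed.

Lemma trace_l_continuous (R : realType) (N : nat) (a h : R)
    (w : 'I_N -> R -> R) (j : 'I_N) :
  continuous (w j) -> inner_l a h w j = w j (xl a h j).
Proof.
by move=> cw; apply: cvg_lim => //; apply: cvg_at_right_filter; exact: cw.
Qed.

Lemma continuous_dV (R : realType) (N n : nat) (v : 'I_N -> {poly R}) j :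
  continuous (dV n v j).
Proof. exact: continuous_horner. Qed.

Lemma xr_xl (R : realType) (N : nat) (a h : R) (j : 'I_N) :
  xr a h j = xl a h j + h.
Proof. by rewrite /xr /xl mulrSr addrA. Qed.

(** No convergence is assumed: a limit that does not exist has the default value
0. This matters for traces of the diffusion coefficient, which need not be
continuous. *)
Lemma lim_ge0 (R : realType) (F : set_system R) (FF : ProperFilter F)
    (w : R -> R) :
  (\forall x \near F, 0 <= w x) -> 0 <= lim (w x @[x --> F]).
Proof.
move=> w0; have [cw|dw] := pselect (cvg (w x @[x --> F])).
  exact: limr_ge.
by rewrite (dvgP dw).
Qed.

Lemma avg_ge0 (R : realType) (N : nat) (a h : R) (w : 'I_N -> R -> R) :
  0 < h ->
  (forall j x, xl a h j <= x <= xr a h j -> 0 <= w j x) ->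
  forall j, 0 <= avg a h w j.
Proof.
move=> h0 w0 j.
have lr i : xl a h i < xr a h i by rewrite /xl /xr mulrS; lra.
rewrite /avg divr_ge0// addr_ge0//; apply: lim_ge0.
- near=> x; apply: w0; apply/andP; split; apply: ltW; near: x.
  + exact/nbhs_left_gt/lr.
  + exact: nbhs_left_lt.
- near=> x; apply: w0; apply/andP; split; apply: ltW; near: x.
  + exact: nbhs_right_gt.
  + exact/nbhs_right_lt/lr.
Unshelve. all: by end_near. Qed.

Lemma mesh_sub_domain (R : realType) (N : nat) (a h x : R) (j : 'I_N) :
  0 < h -> xl a h j <= x <= xr a h j -> a <= x <= a + h *+ N.
Proof.
move=> h0 /andP[xl_x x_xr]; apply/andP; split.
  by apply: le_trans xl_x; rewrite /xl lerDl mulrn_wge0 // ltW.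
by apply: le_trans x_xr _; rewrite /xr lerD2l ler_wpMn2l // ltW.
Qed.

(** * The CFL conditions as real inequalities *)

(** Turns a bound by an extended-real quotient into a product inequality, which
also covers the zero denominators, where the quotient is infinite and the
product inequality is trivial. *)
Lemma lee_div_cross (R : realType) (x c a n d : R) :
  0 < c -> 0 <= a -> 0 <= n -> 0 <= d ->
  (x%:E <= c%:E * a%:E^-1 * (n%:E / d%:E))%E -> x * a * d <= c * n.
Proof.
move=> c0 a0 n0 d0.
have cn0 : 0 <= c * n by rewrite mulr_ge0// ltW.
have [->|aN0] := eqVneq a 0; first by rewrite mulr0 mul0r.
have [->|dN0] := eqVneq d 0; first by rewrite mulr0.
have {}a0 : 0 < a by rewrite lt0r aN0.
have {}d0 : 0 < d by rewrite lt0r dN0.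
rewrite !inver (negPf aN0) (negPf dN0) -!EFinM lee_fin => xle.
rewrite -ler_pdivlMr// -ler_pdivlMr//.
by apply: le_trans xle _; rewrite le_eqVlt; apply/orP; left; apply/eqP; ring.
Qed.

(** The two bounds are half the endpoint weights of [nodal_average]. A negative [L]
(possible when c1 = c2) makes the left-hand sides nonpositive. *)
Lemma lambda0_bound (R : realType) (x L g : R) :
  0 <= x -> -1 / 3 < g < 1 / 3 -> (x%:E <= lambda0 L g)%E ->
  x * L <= (1 + 3 * g) / (12 * (1 + g)) /\
  x * L <= (1 - 3 * g) / (12 * (1 - g)).
Proof.
move=> x0 g13; have [gD gB _] := @reference_nodes_distinct _ g ltac:(lra).
move=> xle; have [L0|L0] := ltP L 0.
  have xL0 : x * L <= 0 by rewrite mulr_ge0_le0// ltW.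
  by split; apply: le_trans xL0 _; rewrite divr_ge0//; lra.
have LE n d : (mine ((1 + 3 * g)%:E / (6 * (1 + g))%:E)
        ((1 - 3 * g)%:E / (6 * (1 - g))%:E) <= n%:E / d%:E)%E ->
    0 <= n -> 0 <= d -> x * L * d <= n / 2.
  move=> le n0 d0.
  have /lee_div_cross -/(_ ltr01) H :
      (x%:E <= 1%:E * (2 * L)%:E^-1 * (n%:E / d%:E))%E.
    rewrite mul1e; apply: le_trans xle _; apply: lee_wpmul2l le.
    by rewrite inve_ge0 lee_fin; lra.
  by move: H; rewrite mul1r => H; have := H ltac:(lra) n0 d0; lra.
have H1 := LE (1 + 3 * g) (6 * (1 + g)).
have H2 := LE (1 - 3 * g) (6 * (1 - g)).
move: H1 H2; rewrite !ge_min !lexx orbT => /(_ isT) H1 /(_ isT) H2.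
by split; rewrite ler_pdivlMr; [have := H1; lra|lra|have := H2; lra|lra].
Qed.

(** Since every interface average of A is at most the maximum, its inverse is at
least the inverse of the maximum, so the maximum may be replaced by any of
them. *)
Lemma mu0_bound (R : realType) (N : nat) (a h x b0 b1 g : R)
    (A : R -> R -> R) (u : 'I_N -> {poly R}) :
  1 <= b0 -> b1 <= 1 / 4 -> -1 / 3 < g < 1 / 3 -> `|g| <= 8 * b1 - 1 ->
  (forall i, 0 <= avg a h (Ah A u) i) ->
  (x%:E <= mu0 a h A u b0 b1 g)%E ->
  forall i, let m := x * avg a h (Ah A u) i in
    [/\ m * (b0 * (1 + g) + 8 * b1 - 2) <= 12^-1 * (1 + 3 * g),
       m * (b0 * (1 - g) + 8 * b1 - 2) <= 12^-1 * (1 - 3 * g) &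
       m * (1 - 4 * b1) <= 12^-1 * 2].
Proof.
move=> b01 b1u g13; rewrite ler_norml => gle avg0 xle i m.
set Amax := (\big[maxe/-oo]_(j < N) (avg a h (Ah A u) j)%:E)%E in xle.
have Ai : ((avg a h (Ah A u) i)%:E <= Amax)%E by exact: le_bigmax.
have Ai0 : (0 <= (avg a h (Ah A u) i)%:E)%E by rewrite lee_fin.
have A0 := le_trans Ai0 Ai.
have LE n d :
    (mine ((1 + 3 * g)%:E / (b0 * (1 + g) + 8 * b1 - 2)%:E)
     (mine ((1 - 3 * g)%:E / (b0 * (1 - g) + 8 * b1 - 2)%:E)
           (2%:E / (1 - 4 * b1)%:E)) <= n%:E / d%:E)%E ->
    0 <= n -> 0 <= d -> m * d <= 12^-1 * n.
  move=> le n0 d0; apply: lee_div_cross => //; apply: le_trans xle _.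
  have c0 : (0 <= (12^-1)%:E :> \bar R)%E by rewrite lee_fin.
  apply: (@le_trans _ _ ((12^-1)%:E * Amax^-1 * (n%:E / d%:E))%E).
    by apply: lee_wpmul2l le; rewrite mule_ge0// inve_ge0.
  apply: lee_wpmul2r; first by rewrite mule_ge0// ?inve_ge0 lee_fin.
  by apply: lee_wpmul2l => //; rewrite lee_pV2.
split; apply: LE; rewrite ?ge_min ?lexx ?orbT//; nra.
Qed.

(** * Convection *)

Lemma lipschitz_on_le (R : realType) (L : R) (S : set R) (f : R -> R) :
  L.-lipschitz_S f -> {in S &, forall x y, `|f x - f y| <= L * `|x - y|}.
Proof. by move=> H x y /set_mem xS /set_mem yS; apply: (H (x, y)). Qed.

(** Raising the outer arguments [x1] and [x4] helps by monotonicity of the flux.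
Raising the inner ones [x2] and [x3] costs at most [lam * L] per unit, which the
weights [w1] and [w3] pay for. *)
Lemma flux_difference_monotone (R : realType) (f : R -> R)
    (fhat : R -> R -> R) (c1 c2 L lam w1 w3 : R) :
  monotone_flux f c1 c2 L fhat -> 0 <= lam -> lam * L <= w1 -> lam * L <= w3 ->
  forall x1 x2 x3 x4 y1 y2 y3 y4 : R,
  c1 <= x1 <= y1 -> c1 <= x2 <= y2 -> c1 <= x3 <= y3 -> c1 <= x4 <= y4 ->
  y1 <= c2 -> y2 <= c2 -> y3 <= c2 -> y4 <= c2 ->
  w1 * x2 + w3 * x3 - lam * (fhat x3 x4 - fhat x1 x2) <=
  w1 * y2 + w3 * y3 - lam * (fhat y3 y4 - fhat y1 y2).
Proof.
move=> [lipl lipr incl decr _] lam0 lw1 lw3 x1 x2 x3 x4 y1 y2 y3 y4.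
move=> /andP[c1x1 h1] /andP[c1x2 h2] /andP[c1x3 h3] /andP[c1x4 h4] u1 u2 u3 u4.
have I x y : c1 <= x -> x <= y -> y <= c2 -> x \in `[c1, c2] /\ y \in `[c1, c2].
  by move=> cx xy yc; rewrite !in_itv/=; split; lra.
have [i1 k1] := I _ _ c1x1 h1 u1; have [i2 k2] := I _ _ c1x2 h2 u2.
have [i3 k3] := I _ _ c1x3 h3 u3; have [i4 k4] := I _ _ c1x4 h4 u4.
have out : fhat y3 y4 <= fhat x3 x4 + L * (y3 - x3).
  apply: le_trans (decr _ k3 _ _ k4 i4 h4) _.
  have := @lipschitz_on_le _ _ _ _ (lipl _ i4) y3 x3.
  rewrite !inE /= => /(_ k3 i3).
  rewrite (ger0_norm (_ : 0 <= y3 - x3)) ?subr_ge0//.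
  by move=> /ler_normlW; lra.
have inn : fhat x1 x2 - L * (y2 - x2) <= fhat y1 y2.
  apply: le_trans (incl _ k2 _ _ i1 k1 h1).
  have := @lipschitz_on_le _ _ _ _ (lipr _ i1) x2 y2.
  rewrite !inE /= => /(_ i2 k2); rewrite (distrC x2).
  rewrite (ger0_norm (_ : 0 <= y2 - x2)) ?subr_ge0// => /ler_normlW.
  by lra.
have := ler_wpM2l lam0 out; have := ler_wpM2l lam0 inn.
have : lam * L * (y2 - x2) <= w1 * (y2 - x2) by rewrite ler_wpM2r// subr_ge0.
have : lam * L * (y3 - x3) <= w3 * (y3 - x3) by rewrite ler_wpM2r// subr_ge0.
lra.
Qed.

(** * Diffusion *)

(** [x * p + y * t] is at most [p + t] times the larger of [x] and [y]. *)
Lemma split_weight (R : realType) (x y p t w : R) : 0 <= p -> 0 <= t ->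
  x * (p + t) <= w -> y * (p + t) <= w -> x * p + y * t <= w.
Proof. by move=> p0 t0 xw yw; have [xy|/ltW yx] := leP x y; nra. Qed.

(** The middle node keeps its full weight here, only the endpoint weights being
halved: with half of the middle weight the third CFL bound would have to be
twice as strict. With k = 2 - 8 b1, the flux through an interface is
  - p l1 - q m1 - s r1 + t l2 + q m2 + r' r2
with nonnegative p, q, r', s, t. For q this is k >= 0; for p and r' it
is k <= 1 + g and k <= 1 - g, which is the condition on |g|; then b0 >= 1 gives
s and t. The values on the cell itself count negatively through both interfaces, and the three CFL bounds
compare p + t, q and r' + s with the quadrature weights. *)
Lemma diffusion_ge0 (R : realType) (g b0 b1 mi mj : R) :
  1 <= b0 -> b1 <= 1 / 4 -> -1 < g < 1 -> `|g| <= 8 * b1 - 1 ->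
  0 <= mi -> 0 <= mj ->
  {in [:: mi; mj], forall m,
    [/\ m * (b0 * (1 + g) + 8 * b1 - 2) <= 12^-1 * (1 + 3 * g),
       m * (b0 * (1 - g) + 8 * b1 - 2) <= 12^-1 * (1 - 3 * g) &
       m * (1 - 4 * b1) <= 12^-1 * 2]} ->
  forall l0 m0 r0 l m r l1 m1 r1 : R,
  0 <= l0 -> 0 <= m0 -> 0 <= r0 -> 0 <= l -> 0 <= m -> 0 <= r ->
  0 <= l1 -> 0 <= m1 -> 0 <= r1 ->
  0 <= nodal_average g l m r - ((1 + 3 * g) / (12 * (1 + g)) * l +
                       (1 - 3 * g) / (12 * (1 - g)) * r) +
       (mj * nodal_flux g b0 b1 l m r l1 m1 r1 -
        mi * nodal_flux g b0 b1 l0 m0 r0 l m r).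
Proof.
move=> b01 b1le g1 gle mi0 mj0 cfl l0 m0 r0 l m r l1 m1 r1 *.
have [gD gB gS] := reference_nodes_distinct g1.
have {g1} [gD0 gB0] : 0 < 1 + g /\ 0 < 1 - g by lra.
have {gle} [gle1 gle2] : g <= 8 * b1 - 1 /\ - g <= 8 * b1 - 1.
  by move: gle; rewrite ler_norml; lra.
have gS0 : 0 < 1 - g ^+ 2 by nra.
pose k := 2 - 8 * b1.
pose p := (1 - k / (1 + g)) / 2; pose r' := (1 - k / (1 - g)) / 2.
pose q := k / (1 - g ^+ 2).
pose s := b0 - 1 + r'; pose t := b0 - 1 + p.
have p0 : 0 <= p by rewrite divr_ge0// subr_ge0 ler_pdivrMr// /k; lra.
have r'0 : 0 <= r' by rewrite divr_ge0// subr_ge0 ler_pdivrMr// /k; lra.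
have q0 : 0 <= q by rewrite divr_ge0 ?(ltW gS0)// /k; lra.
have s0 : 0 <= s by rewrite /s; lra.
have t0 : 0 <= t by rewrite /t; lra.
have cfl_l x : x \in [:: mi; mj] ->
    x * (p + t) <= (1 + 3 * g) / (12 * (1 + g)).
  move=> /cfl[c _ _]; rewrite -(ler_pM2r gD0).
  have -> : x * (p + t) * (1 + g) = x * (b0 * (1 + g) + 8 * b1 - 2).
    by rewrite /t /p /k; field.
  by apply: le_trans c _; rewrite le_eqVlt; apply/orP; left; apply/eqP; field.
have cfl_r x : x \in [:: mi; mj] ->
    x * (r' + s) <= (1 - 3 * g) / (12 * (1 - g)).
  move=> /cfl[_ c _]; rewrite -(ler_pM2r gB0).
  have -> : x * (r' + s) * (1 - g) = x * (b0 * (1 - g) + 8 * b1 - 2).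
    by rewrite /s /r' /k; field.
  by apply: le_trans c _; rewrite le_eqVlt; apply/orP; left; apply/eqP; field.
have cfl_m x : x \in [:: mi; mj] -> x * q <= 1 / (3 * (1 - g ^+ 2)).
  move=> /cfl[_ _ c]; rewrite -(ler_pM2r gS0).
  have -> : x * q * (1 - g ^+ 2) = 2 * (x * (1 - 4 * b1)).
    by rewrite /q /k; field.
  have -> : 1 / (3 * (1 - g ^+ 2)) * (1 - g ^+ 2) = 1 / 3 by field.
  by lra.
have [ii jj] : mi \in [:: mi; mj] /\ mj \in [:: mi; mj].
  by rewrite !inE !eqxx orbT.
have cl : mj * p + mi * t <= (1 + 3 * g) / (12 * (1 + g)).
  by apply: split_weight => //; exact: cfl_l.
have cr : mi * r' + mj * s <= (1 - 3 * g) / (12 * (1 - g)).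
  by apply: split_weight => //; exact: cfl_r.
have cm : (mi + mj) * q <= 2 / (3 * (1 - g ^+ 2)).
  have := cfl_m _ ii; have := cfl_m _ jj; rewrite [(mi + mj) * q]mulrDl.
  have -> : 2 / (3 * (1 - g ^+ 2)) =
    1 / (3 * (1 - g ^+ 2)) + 1 / (3 * (1 - g ^+ 2)) by field.
  by lra.
have -> : nodal_average g l m r - ((1 + 3 * g) / (12 * (1 + g)) * l +
                       (1 - 3 * g) / (12 * (1 - g)) * r) +
       (mj * nodal_flux g b0 b1 l m r l1 m1 r1 -
        mi * nodal_flux g b0 b1 l0 m0 r0 l m r) =
  ((1 + 3 * g) / (12 * (1 + g)) - (mj * p + mi * t)) * l +
  (2 / (3 * (1 - g ^+ 2)) - (mi + mj) * q) * m +
  ((1 - 3 * g) / (12 * (1 - g)) - (mi * r' + mj * s)) * r +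
  mj * (t * l1 + q * m1 + r' * r1) + mi * (p * l0 + q * m0 + s * r0).
  rewrite /nodal_average /nodal_flux /nodal_curvature /s /t /p /r' /q /k.
  by field; rewrite ?gD ?gB ?gS.
(* With transparent coefficients the search for nonnegative summands below would
   go into their definitions. *)
clearbody s t p r' q.
rewrite -subr_ge0 in cl; rewrite -subr_ge0 in cm; rewrite -subr_ge0 in cr.
by do ![assumption | apply: addr_ge0 | apply: mulr_ge0].
Qed.

(** * The maximum principle *)

(** Testing with the constant 1 removes the volume integrals of the
right-hand side and the interface correction, as both carry a derivative of the test function. *)
Lemma average_update (R : realType) (N : nat) (a h tau g : R)
    (f : R -> R) (A fhat : R -> R -> R) (b0 b1 : R) (u u' : 'I_N -> {poly R})
    (vl := fun i => (u i).[xl a h i])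
    (vm := fun i => (u i).[mid_node g h (xl a h i)])
    (vr := fun i => (u i).[xl a h i + h])
    (F := fun i => nodal_flux g b0 b1 (vl i) (vm i) (vr i)
             (vl (ordS i)) (vm (ordS i)) (vr (ordS i))) :
  0 < h -> 0 < tau -> -1 < g < 1 -> in_Vh 2 u -> in_Vh 2 u' ->
  ddg_step a h 2 f fhat A b0 b1 tau u u' -> forall j,
  cell_average a h u' j =
  nodal_average g (vl j) (vm j) (vr j) -
  tau / h * (fhat (vr j) (vl (ordS j)) - fhat (vr (ord_pred j)) (vl j)) +
  (tau / h ^+ 2 * avg a h (Ah A u) j * F j -
   tau / h ^+ 2 * avg a h (Ah A u) (ord_pred j) * F (ord_pred j)).
Proof.
move=> h0 tau0 g1 su su' step j.
have tR n (v : 'I_N -> {poly R}) i :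
    inner_r a h (dV n v) i = (v i)^`(n).[xl a h i + h].
  by rewrite trace_r_continuous ?xr_xl//; exact: continuous_dV.
have tL n (v : 'I_N -> {poly R}) i :
    inner_l a h (dV n v) i = (v i)^`(n).[xl a h i].
  by rewrite trace_l_continuous//; exact: continuous_dV.
have fluxE i : diff_flux a h b0 b1 u i = F i / h.
  rewrite /diff_flux /jump /avg /trp /trm !tR !tL.
  exact: (diff_flux_nodal _ _ b0 b1 h0 g1 (su i) (su (ordS i))).
have convE i : conv_flux a h fhat u i = fhat (vr i) (vl (ordS i)).
  by rewrite /conv_flux /trp /trm tR tL.
pose one : 'I_N -> {poly R} := fun=> 1%:P.
have one_Vh : in_Vh 2 one.
  by move=> i; rewrite (leq_trans (size_polyC_leq1 _)).
have d0 x : dV 0 one j x = 1 by rewrite /dV derivn0 hornerC.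
have d1 x : dV 1 one j x = 0 by rewrite /dV derivn1 derivC horner0.
have := step one one_Vh j; cbv zeta.
rewrite !fluxE !convE !tR !tL /= !derivC !horner0 !hornerC !mulr0 !addr0 !mulr1.
rewrite ord_predK.
have int0 (w : R -> R) :
    \int[lebesgue_measure]_(x in cell a h j) (w x * dV 1 one j x) = 0.
  under eq_Rintegral => x _ do rewrite d1 mulr0.
  by rewrite /Rintegral integral0.
rewrite !int0.
have -> : \int[lebesgue_measure]_(x in cell a h j)
    ((dV 0 u' j x - dV 0 u j x) / tau * dV 0 one j x) =
    \int[lebesgue_measure]_(x in `[xl a h j, xl a h j + h])
      (tau^-1 *: (u' j - u j)).[x].
  rewrite /cell xr_xl; apply: eq_Rintegral => x _.
  by rewrite d0 mulr1 hornerZ !hornerE mulrC.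
have sZ : (size (tau^-1 *: (u' j - u j)) <= 3)%N.
  rewrite (leq_trans (size_scale_leq _ _))// (leq_trans (size_polyD _ _))//.
  by rewrite geq_max size_polyN su su'.
rewrite (Rintegral_quadratic _ h0 g1 sZ) => upd.
have -> : cell_average a h u' j = nodal_average g (u' j).[xl a h j]
    (u' j).[mid_node g h (xl a h j)] (u' j).[xl a h j + h].
  rewrite /cell_average /cell xr_xl.
  rewrite (Rintegral_quadratic _ h0 g1 (su' j)) mulKf//.
  by rewrite gt_eqF.
have [gD gB gS] := reference_nodes_distinct g1.
have [hN0 tN0] : h != 0 /\ tau != 0 by rewrite !gt_eqF.
set Q' := nodal_average g (u' j).[_] _ _.
have -> : Q' = nodal_average g (vl j) (vm j) (vr j) +
   tau / h * (h * nodal_average g (tau^-1 *: (u' j - u j)).[xl a h j]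
      (tau^-1 *: (u' j - u j)).[mid_node g h (xl a h j)]
      (tau^-1 *: (u' j - u j)).[xl a h j + h]).
  rewrite /Q' /nodal_average /vl /vm /vr !hornerZ !hornerD !hornerN.
  by field; rewrite ?gD ?gB ?gS ?hN0 ?tN0.
by rewrite upd; field; rewrite hN0.
Qed.

Theorem theorem2p3 (R : realType) (N : nat) (a h tau : R)
    (f : R -> R) (A fhat : R -> R -> R) (c1 c2 L beta0 beta1 gamma : R)
    (u u' : 'I_N -> {poly R}) :
  (0 < N)%N -> 0 < h -> 0 < tau -> c1 <= c2 ->
  smooth f ->
  (forall x v : R, a <= x <= a + h *+ N -> 0 <= A x v) ->
  monotone_flux f c1 c2 L fhat ->
  1 <= beta0 -> 1 / 8 <= beta1 <= 1 / 4 ->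
  - (1 / 3) < gamma < 1 / 3 -> `|gamma| <= 8 * beta1 - 1 ->
  in_Vh 2 u -> in_Vh 2 u' ->
  ddg_step a h 2 f fhat A beta0 beta1 tau u u' ->
  ((tau / h)%:E <= lambda0 L gamma)%E ->
  ((tau / h ^+ 2)%:E <= mu0 a h A u beta0 beta1 gamma)%E ->
  (forall j : 'I_N, {in Spoints a h gamma j, forall x, c1 <= (u j).[x] <= c2}) ->
  forall j : 'I_N, c1 <= cell_average a h u' j <= c2.
Proof.
move=> _ h0 tau0 c12 _ A0 mono b0 /andP[_ b1] g13 gle su su' step lam mu uS j.
have g1 : -1 < gamma < 1 by lra.
have {}g13 : -1 / 3 < gamma < 1 / 3 by lra.
rewrite (average_update h0 tau0 g1 su su' step).
set i := ord_pred j; rewrite (ord_predK j : ordS i = j).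
have a0 : forall k, 0 <= avg a h (Ah A u) k.
  by apply: avg_ge0 => // k x xk; exact/A0/(mesh_sub_domain h0 xk).
have x0 : 0 <= tau / h ^+ 2 by rewrite divr_ge0 ?exprn_ge0 ?ltW.
have l0 : 0 <= tau / h by rewrite divr_ge0 ?ltW.
have [lam1 lam2] := lambda0_bound l0 g13 lam.
have mub := mu0_bound b0 b1 g13 gle a0 mu.
have nodes k : [/\ c1 <= (u k).[xl a h k] <= c2,
    c1 <= (u k).[mid_node gamma h (xl a h k)] <= c2 &
    c1 <= (u k).[xl a h k + h] <= c2].
  have mE : xmid a h k = xl a h k + h / 2.
    by rewrite /xmid xr_xl; field.
  split.
  - have -> : xl a h k = xmid a h k + h / 2 * -1 by rewrite mE; ring.
    by apply: uS; rewrite !inE eqxx.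
  - have -> : mid_node gamma h (xl a h k) = xmid a h k + h / 2 * gamma.
      by rewrite mE /mid_node; ring.
    by apply: uS; rewrite !inE eqxx orbT.
  - have -> : xl a h k + h = xmid a h k + h / 2 * 1 by rewrite mE; field.
    by apply: uS; rewrite !inE eqxx !orbT.
have [/andP[] + + /andP[] + + /andP[] + +] := nodes i.
have [/andP[] + + /andP[] + + /andP[] + +] := nodes j.
have [/andP[] + + /andP[] + + /andP[] + +] := nodes (ordS j).
set L1 := _.[_]; set M1 := _.[_]; set R1 := _.[_] => L1l L1u M1l M1u R1l R1u.
set L2 := _.[_]; set M2 := _.[_]; set R2 := _.[_] => L2l L2u M2l M2u R2l R2u.
set L3 := _.[_]; set M3 := _.[_]; set R3 := _.[_] => L3l L3u M3l M3u R3l R3u.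
have conv := flux_difference_monotone mono l0 lam1 lam2.
have mub_ij : {in [:: tau / h ^+ 2 * avg a h (Ah A u) i;
    tau / h ^+ 2 * avg a h (Ah A u) j], forall m,
    [/\ m * (beta0 * (1 + gamma) + 8 * beta1 - 2) <= 12^-1 * (1 + 3 * gamma),
       m * (beta0 * (1 - gamma) + 8 * beta1 - 2) <= 12^-1 * (1 - 3 * gamma) &
       m * (1 - 4 * beta1) <= 12^-1 * 2]}.
  by move=> m; rewrite !inE => /orP[] /eqP ->; exact: mub.
have diff := diffusion_ge0 b0 b1 g1 gle
  (mulr_ge0 x0 (a0 i)) (mulr_ge0 x0 (a0 j)) mub_ij.
have := nodal_average_cst c1 g1; have := nodal_average_cst c2 g1.
rewrite /nodal_average => q2 q1.
apply/andP; split.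
- have := conv c1 c1 c1 c1 R3 L2 R2 L1.
  rewrite subrr mulr0 subr0 !lexx R3l L2l R2l L1l => /(_ isT isT isT isT).
  move=> /(_ R3u L2u R2u L1u) C.
  have := diff (L3 - c1) (M3 - c1) (R3 - c1) (L2 - c1) (M2 - c1) (R2 - c1)
    (L1 - c1) (M1 - c1) (R1 - c1).
  rewrite !subr_ge0 => /(_ L3l M3l R3l L2l M2l R2l L1l M1l R1l).
  rewrite !nodal_fluxB /nodal_average; lra.
- have := conv R3 L2 R2 L1 c2 c2 c2 c2.
  rewrite subrr mulr0 subr0 !lexx R3l L2l R2l L1l R3u L2u R2u L1u.
  move=> /(_ isT isT isT isT isT isT isT isT) C.
  have flip x : c2 - x = - (x - c2) by rewrite opprB.
  have := diff (c2 - L3) (c2 - M3) (c2 - R3) (c2 - L2) (c2 - M2) (c2 - R2)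
    (c2 - L1) (c2 - M1) (c2 - R1).
  rewrite !subr_ge0 => /(_ L3u M3u R3u L2u M2u R2u L1u M1u R1u).
  rewrite !flip !nodal_fluxN !nodal_fluxB /nodal_average; lra.
Qed.
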